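(* Let $M=(V,D)$ be a vf-closed $\Delta$-matroid and $n=|V|$. If $M$ is strongly divisible by $u\in V$, then \[Q_1(M)=Q_1(M\setminus u)+Q_1(M*u\setminus u)+Q_1(M\,\bar{*}\,u\setminus u).\] If $M$ is not strongly divisible, then $Q_1(M)=(y+2)^n$.
   Context: A set system is $M=(V,D)$ with $V$ finite, $D$ a family of subsets of $V$; write $Z\in M$ for $Z\in D$; proper means $D\neq\emptyset$. $\oplus$ is symmetric difference. Pivot: $M*X=(V,\{Z\oplus X:Z\in D\})$; loop complementation: $M+w=(V,D\oplus\{Z\cup\{w\}:Z\in D,w\notin Z\})$; operations are applied left to right; dual pivot $M\,\bar{*}\,w=M+w*w+w$; operations on distinct elements commute, and $M\,\bar{*}\,X$ denotes applying $\bar{*}\,w$ for all $w\in X$. $M\setminus u=(V\setminus\{u\},\{Z\in D:u\notin Z\})$. For proper $M$, $d_M(X)=\min\{|X\oplus Z|:Z\in M\}$, $d_M=d_M(\emptyset)$, and $Q_1(M)=\sum_{X,Y\subseteq V,\,X\cap Y=\emptyset}y^{d_{M*Y\,\bar{*}\,X}}$. A $\Delta$-matroid is a proper set system such that for all $X,Y\in M$ and $w\in X\oplus Y$, either $X\oplus\{w\}\in M$ or some $v\in X\oplus Y$, $v\neq w$, has $X\oplus\{w,v\}\in M$. $M$ is a vf-closed $\Delta$-matroid if $M\varphi$ is a $\Delta$-matroid for every sequence $\varphi$ of pivots and loop complementations on elements of $V$. $M$ is divisible by $u$ if some $X_1,X_2\in M$ have $u\in X_1\oplus X_2$; strongly divisible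 by $u$ if moreover some $X\in M$ has $X\oplus\{u\}\notin M$; strongly divisible if strongly divisible by some $u\in V$. *)

(* Defs.v *)
From mathcomp Require Import all_boot all_order all_algebra.

Set Implicit Arguments.
Unset Strict Implicit.
Unset Printing Implicit Defensive.

Import GRing.Theory.
Local Open Scope ring_scope.

Definition symdiff (I : finType) (A B : {set I}) : {set I} :=
  (A :\: B) :|: (B :\: A).

Notation "A '(+:)' B" := (symdiff A B) (at level 52, left associativity).

(* The ground set is a subset of an ambient finite type, so that deletion stays
   in the same type.  The record is raw: that the feasible sets are
   subsets of the ground set is the separate predicate [is_set_system]. *)
Record set_system (T : finType) :=
  SetSystem { ground : {set T}; feasible : {set {set T}} }.

Section SetSystems.
Variable T : finType.
Implicit Types (M : set_system T) (X Y Z : {set T}) (u v w : T).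

Definition is_set_system M : Prop := feasible M \subset powerset (ground M).

Definition proper_system M : Prop := feasible M != set0.

Definition pivot M X : set_system T :=
  SetSystem (ground M) [set Z (+:) X | Z in feasible M].

Definition loopc M w : set_system T :=
  SetSystem (ground M)
    (feasible M (+:) [set Z :|: [set w] | Z in feasible M & w \notin Z]).

Definition dual_pivot1 M w : set_system T :=
  loopc (pivot (loopc M w) [set w]) w.

(* Dual pivots on distinct elements commute, so the enumeration order of [X] is
   immaterial. *)
Definition dual_pivot M X : set_system T := foldl dual_pivot1 M (enum X).

Definition delete M u : set_system T :=
  SetSystem (ground M :\ u) [set Z in feasible M | u \notin Z].

(* The default value #|T| bounds every #|X (+:) Z|, so for proper [M] this is
   the minimum over the feasible sets. *)
Definition distance M X : nat :=
  \big[minn/#|T|]_(Z in feasible M) #|X (+:) Z|.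

Definition Q1 M : {poly int} :=
  \sum_(X in powerset (ground M))
    \sum_(Y in powerset (ground M) | [disjoint X & Y])
      'X^(distance (dual_pivot (pivot M Y) X) set0).

Definition delta_matroid M : Prop :=
  [/\ is_set_system M, proper_system M &
    forall X Y w, X \in feasible M -> Y \in feasible M -> w \in X (+:) Y ->
      X (+:) [set w] \in feasible M \/
      exists v, [/\ v \in X (+:) Y, v != w & X (+:) [set w; v] \in feasible M]].

Inductive vf_op := Pivot of T | LoopC of T.

Definition vf_elt (o : vf_op) : T :=
  match o with Pivot w => w | LoopC w => w end.

Definition vf_apply M (o : vf_op) : set_system T :=
  match o with Pivot w => pivot M [set w] | LoopC w => loopc M w end.

Definition vf_closed_delta_matroid M : Prop :=
  forall phi : seq vf_op,
    all (fun o => vf_elt o \in ground M) phi ->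
    delta_matroid (foldl vf_apply M phi).

Definition divisible_by M u : Prop :=
  exists X1 X2,
    [/\ X1 \in feasible M, X2 \in feasible M & u \in X1 (+:) X2].

Definition strongly_divisible_by M u : Prop :=
  divisible_by M u /\
  exists2 X, X \in feasible M & X (+:) [set u] \notin feasible M.

Definition strongly_divisible M : Prop :=
  exists2 u, u \in ground M & strongly_divisible_by M u.

End SetSystems.

(* Main.v *)
Require Import Defs.
From mathcomp Require Import all_boot all_order all_algebra.
From mathcomp Require Import zify ring.

Import GRing.Theory.
Local Open Scope ring_scope.

(** Over subsets avoiding [u], the feasible sets of [M\u], [M*u\u] and
    [M\bar*u\u] have indicator functions [a], [b] and [a xor b], where [a]
    and [b] record the feasible sets of [M] avoiding, resp. containing, [u].
    Splitting the sum defining [Q1] according to whether [u] lies in [X], in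
    [Y], or in neither, each disjoint pair [(X, Y)] avoiding [u] contributes
    the exponents [min(d_a, d_b + 1)], [min(d_b, d_a + 1)] and
    [min(d_(a xor b), d_b + 1)], the distances being taken after applying the
    operations given by [(X, Y)], which commute with those at [u].

    Strong divisibility by [u] says that all three minors are proper, and then
    the exchange axiom bounds the distances by one another plus one, so the
    exponents collapse to [d_a], [d_b] and [d_(a xor b)].  Otherwise one minor
    is empty and the other two are equal, to [N] say, so that
    [Q1 M = (y + 2) * Q1 N], and [N] is again not strongly divisible. *)

Section SetSystemTheory.
Set Implicit Arguments.
Unset Strict Implicit.

Variable T : finType.
Implicit Types (M : set_system T) (X Y Z A B : {set T}) (u v w : T).

(** * Symmetric difference *)

Lemma in_symdiff (I : finType) (A B : {set I}) x :
  (x \in A (+:) B) = (x \in A) (+) (x \in B).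
Proof. by rewrite !inE; case: (x \in A); case: (x \in B). Qed.

Lemma symdiffA : associative (@symdiff T).
Proof. by move=> A B C; apply/setP=> x; rewrite !in_symdiff addbA. Qed.

Lemma symdiffC : commutative (@symdiff T).
Proof. by move=> A B; apply/setP=> x; rewrite !in_symdiff addbC. Qed.

Lemma symdiffAC : right_commutative (@symdiff T).
Proof. by move=> A B C; rewrite -!symdiffA (symdiffC B). Qed.

Lemma symdiff0 A : A (+:) set0 = A.
Proof. by apply/setP=> x; rewrite in_symdiff inE addbF. Qed.

Lemma symdiffK B : involutive (fun A => A (+:) B).
Proof. by move=> A; apply/setP=> x; rewrite !in_symdiff addbK. Qed.

Lemma symdiff1_notin A u : u \notin A -> A (+:) [set u] = u |: A.
Proof.
move=> uA; apply/setP=> x; rewrite in_symdiff !inE.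
by case: eqP => [->|_]; rewrite ?addbF ?addbT ?uA.
Qed.

Lemma symdiff1_in A u : u \in A -> A (+:) [set u] = A :\ u.
Proof.
move=> uA; apply/setP=> x; rewrite in_symdiff !inE.
by case: eqP => [->|_]; rewrite ?addbF ?addbT ?uA.
Qed.

Lemma in_symdiff1 A u v : (v \in A (+:) [set u]) = (v \in A) (+) (v == u).
Proof. by rewrite in_symdiff inE. Qed.

(** * Membership criteria for the operations on set systems *)

Lemma set_system_eq M N :
  ground M = ground N -> feasible M =i feasible N -> M = N.
Proof. by case: M N => [g f] [g' f'] /= -> /setP ->. Qed.

Lemma in_pivot M Y Z :
  (Z \in feasible (pivot M Y)) = (Z (+:) Y \in feasible M).
Proof.
rewrite -{1}[Z](symdiffK Y).
exact: (mem_imset _ _ (inv_inj (symdiffK Y))).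
Qed.

Lemma in_delete M u Z :
  (Z \in feasible (delete M u)) = (Z \in feasible M) && (u \notin Z).
Proof. by rewrite inE. Qed.

Lemma in_loopc M w Z :
  (Z \in feasible (loopc M w)) =
    (Z \in feasible M) (+) (w \in Z) && (Z (+:) [set w] \in feasible M).
Proof.
rewrite in_symdiff; congr (_ (+) _).
apply/imsetP/andP => [[A]|[wZ ZM]].
  by rewrite inE setUC => /andP[AM wA] ->; rewrite -symdiff1_notin // symdiffK
    in_symdiff1 eqxx addbT.
by exists (Z (+:) [set w]); rewrite ?inE ?ZM ?eqxx ?wZ // symdiff1_in // setUC setD1K.
Qed.

(** Write [(a, b)] for the indicators of a set avoiding [w] and of its union with [[set w]]. The
    three operations give [(a, a xor b)], then [(a xor b, a)], then [(a xor b, b)], so membership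
    changes only for sets avoiding [w]. *)
Lemma in_dual_pivot1 M w Z :
  (Z \in feasible (dual_pivot1 M w)) =
    (Z \in feasible M) (+) (w \notin Z) && (Z (+:) [set w] \in feasible M).
Proof.
rewrite !(in_loopc, in_pivot) in_symdiff1 symdiffK eqxx.
by case: (w \in Z); case: (Z \in _); case: (_ \in _).
Qed.

(** * Involutivity and commutation of the operations *)

Lemma pivotD M X Y : pivot (pivot M X) Y = pivot M (X (+:) Y).
Proof.
by apply: set_system_eq => // Z; rewrite !in_pivot -symdiffA (symdiffC Y).
Qed.

Lemma pivot0 M : pivot M set0 = M.
Proof. by apply: set_system_eq => // Z; rewrite in_pivot symdiff0. Qed.

Lemma pivotK X : involutive (fun M => pivot M X).
Proof. by move=> M; apply: set_system_eq => // Z; rewrite !in_pivot symdiffK. Qed.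

Lemma dual_pivot1K w : involutive (fun M => dual_pivot1 M w).
Proof.
move=> M; apply: set_system_eq => // Z; rewrite !in_dual_pivot1 in_symdiff1.
by rewrite symdiffK eqxx; case: (w \in Z); case: (_ \in _); case: (_ \in _).
Qed.

Lemma dual_pivot1C : right_commutative (@dual_pivot1 T).
Proof.
move=> M v w; have [->//|vw] := eqVneq v w.
apply: set_system_eq => // Z; rewrite !in_dual_pivot1 !in_symdiff1.
rewrite (negPf vw) eq_sym (negPf vw) !addbF (symdiffAC Z [set w]).
case: (v \in Z); case: (w \in Z); rewrite /= ?addbF //.
by rewrite addbA [RHS]addbA (addbAC (Z \in _)).
Qed.

Lemma dual_pivot1_pivot M u Y : u \notin Y ->
  dual_pivot1 (pivot M Y) u = pivot (dual_pivot1 M u) Y.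
Proof.
move=> uY; apply: set_system_eq => // Z.
by rewrite !(in_dual_pivot1, in_pivot) in_symdiff (negPf uY) addbF symdiffAC.
Qed.

Lemma dual_pivot_pivot M X Y : [disjoint X & Y] ->
  dual_pivot (pivot M Y) X = pivot (dual_pivot M X) Y.
Proof.
move=> dXY; have : {in enum X, forall w, w \notin Y}.
  by move=> w; rewrite mem_enum => /(disjointFr dXY) ->.
rewrite /dual_pivot; elim: (enum X) M => //= w s IH M sY.
rewrite dual_pivot1_pivot ?sY ?mem_head // IH // => v vs.
by apply: sY; rewrite in_cons vs orbT.
Qed.

(** Allows the enumeration inside [dual_pivot] to be reordered, since dual pivots commute by
    [dual_pivot1C]. *)
Lemma perm_foldl (S : eqType) (R : Type) (f : R -> S -> R) (x : R) (s t : seq S) :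
  right_commutative f -> perm_eq s t -> foldl f x s = foldl f x t.
Proof.
move=> fC; have f_cat a s1 s2 y :
    foldl f y (s1 ++ a :: s2) = foldl f (f y a) (s1 ++ s2).
  by elim: s1 y => //= b s1 IH y; rewrite IH fC.
elim: s t x => [|a s IH] t x st; first by case: t st => // b t /perm_size.
have /path.splitPr tE : a \in t by rewrite -(perm_mem st) mem_head.
case: tE st => t1 t2; rewrite perm_sym perm_catC /= perm_cons perm_catC perm_sym.
by move=> st; rewrite f_cat; apply: IH.
Qed.

Lemma dual_pivotU1 M u X : u \notin X ->
  dual_pivot M (u |: X) = dual_pivot (dual_pivot1 M u) X.
Proof.
move=> uX.
apply: (@perm_foldl _ _ _ M _ (u :: enum X) dual_pivot1C); apply: uniq_perm.
- exact: enum_uniq.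
- by rewrite /= mem_enum uX enum_uniq.
by move=> v; rewrite in_cons !mem_enum !inE.
Qed.

Lemma dual_pivot_set1 M u : dual_pivot M [set u] = dual_pivot1 M u.
Proof. by rewrite /dual_pivot enum_set1. Qed.

Lemma delete_pivot M u Y : u \notin Y ->
  delete (pivot M Y) u = pivot (delete M u) Y.
Proof.
move=> uY; apply: set_system_eq => // Z.
by rewrite !(in_pivot, in_delete) in_symdiff (negPf uY) addbF.
Qed.

Lemma delete_dual_pivot1 M u w : w != u ->
  delete (dual_pivot1 M w) u = dual_pivot1 (delete M u) w.
Proof.
move=> wu; apply: set_system_eq => // Z.
rewrite !(in_dual_pivot1, in_delete) in_symdiff1 eq_sym (negPf wu) addbF.
by case: (u \in Z); rewrite ?andbT ?andbF.
Qed.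

Lemma delete_dual_pivot M u X : u \notin X ->
  delete (dual_pivot M X) u = dual_pivot (delete M u) X.
Proof.
move=> uX; have : {in enum X, forall w, w != u}.
  by move=> w; rewrite mem_enum; apply: contraTneq => ->.
rewrite /dual_pivot; elim: (enum X) M => //= w s IH M sX.
rewrite IH ?delete_dual_pivot1 ?sX ?mem_head // => v vs.
by apply: sX; rewrite in_cons vs orbT.
Qed.

(** * Twisting by a pair of sets *)

(** Its distance from the empty set is the exponent of the term of [Q1] indexed by [X] and [Y]. *)
Definition twist M X Y := dual_pivot (pivot M Y) X.

Lemma twist_pivot M X Y u : u \notin X ->
  twist (pivot M [set u]) X Y = pivot (twist M X Y) [set u].
Proof.
move=> uX; rewrite /twist -dual_pivot_pivot; last by rewrite disjoint_sym disjoints1.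
by rewrite !pivotD symdiffC.
Qed.

Lemma twist_delete M X Y u : u \notin X -> u \notin Y ->
  twist (delete M u) X Y = delete (twist M X Y) u.
Proof. by move=> uX uY; rewrite /twist delete_dual_pivot // delete_pivot. Qed.

Lemma twistU1l M X Y u : u \notin X -> u \notin Y ->
  twist M (u |: X) Y = twist (dual_pivot1 M u) X Y.
Proof. by move=> uX uY; rewrite /twist dual_pivotU1 // dual_pivot1_pivot. Qed.

Lemma twistU1r M X Y u : u \notin Y ->
  twist M X (u |: Y) = twist (pivot M [set u]) X Y.
Proof. by move=> uY; rewrite /twist pivotD symdiffC symdiff1_notin. Qed.

(** * Preservation of properness *)

Lemma pivot_proper M Y : proper_system (pivot M Y) <-> proper_system M.
Proof.
suff impl K : proper_system K -> proper_system (pivot K Y).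
  by split=> [/impl|/impl //]; rewrite pivotK.
by case/set0Pn=> Z ZK; apply/set0Pn; exists (Z (+:) Y); rewrite in_pivot symdiffK.
Qed.

(** If [Z] is feasible after the dual pivot, then [Z] or [Z (+:) [set w]] was feasible before it;
    the converse follows because the dual pivot is an involution. *)
Lemma dual_pivot1_proper M w : proper_system (dual_pivot1 M w) <-> proper_system M.
Proof.
suff impl K : proper_system (dual_pivot1 K w) -> proper_system K.
  by split=> [/impl //|]; rewrite -{1}(dual_pivot1K w M) => /impl.
case/set0Pn=> Z; rewrite in_dual_pivot1 => ZK; apply/set0Pn.
have [ZM|ZM] := boolP (Z \in feasible K); first by exists Z.
by exists (Z (+:) [set w]); move: ZK; rewrite (negPf ZM) => /andP[].
Qed.

Lemma twist_proper M X Y : proper_system (twist M X Y) <-> proper_system M.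
Proof.
rewrite -(pivot_proper M Y) /twist /dual_pivot.
elim: (enum X) (pivot M Y) => //= w s IH K.
by rewrite IH dual_pivot1_proper.
Qed.

(** * Distance of the empty set and deletion *)

(** Determines the big minimum by its lower bounds; the conjunct on [#|T|] accounts for the default
    value. *)
Lemma distance0_ge M k :
  (k <= distance M set0)%N =
    (k <= #|T|)%N && [forall Z in feasible M, (k <= #|Z|)%N].
Proof.
rewrite /distance; apply/idP/andP=> [kd|[kT /forall_inP kM]]; last first.
  apply: (big_ind (fun m => k <= m)%N) => // [a b ka kb|Z ZM].
    by rewrite leq_min ka kb.
  by rewrite symdiffC symdiff0 kM.
have : (k <= #|T|)%N /\
    forall Z, Z \in index_enum {set T} -> Z \in feasible M -> (k <= #|Z|)%N.
  elim: (index_enum _) kd => [|A s IH]; first by rewrite big_nil.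
  rewrite big_cons; case: ifP => AM.
    rewrite leq_min symdiffC symdiff0 => /andP[kA /IH[kT kM]]; split=> // Z.
    by rewrite inE => /predU1P[->|/kM //].
  move=> /IH[kT kM]; split=> // Z.
  by rewrite inE => /predU1P[->|/kM //]; rewrite AM.
by case=> -> kM; split=> //; apply/forall_inP=> Z; apply: kM; rewrite mem_index_enum.
Qed.

Lemma distance0_le_card M : (distance M set0 <= #|T|)%N.
Proof. by have := leqnn (distance M set0); rewrite distance0_ge => /andP[]. Qed.

Lemma distance0_le M Z : Z \in feasible M -> (distance M set0 <= #|Z|)%N.
Proof.
move=> ZM; have := leqnn (distance M set0).
by rewrite distance0_ge => /andP[_ /forall_inP->].
Qed.

Lemma distance0_attained M :
  proper_system M -> exists2 Z, Z \in feasible M & distance M set0 = #|Z|.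
Proof.
case/set0Pn=> Z0 Z0M; case: (arg_minnP (fun Z : {set T} => #|Z|) Z0M) => Z ZM Zmin.
exists Z => //; apply/eqP; rewrite eqn_leq distance0_le // distance0_ge max_card.
exact/forall_inP.
Qed.

Lemma distance0_nonproper M : ~ proper_system M -> distance M set0 = #|T|.
Proof.
move=> /negP/negPn/eqP M0; rewrite /distance big_pred0 // => Z.
by rewrite M0 inE.
Qed.

(** A set avoiding [u] is a proper subset of [T]. Strictness matters when this minor is compared
    with an empty one, whose distance is [#|T|]. *)
Lemma distance0_delete_lt M u :
  proper_system (delete M u) -> (distance (delete M u) set0 < #|T|)%N.
Proof.
case/distance0_attained=> Z; rewrite in_delete => /andP[_ uZ] ->.
by rewrite -cardsT; apply: proper_card; rewrite properT; apply: contraNneq uZ => ->.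
Qed.

(* No properness is needed: the distance of an empty system is #|T|, and every
   set avoiding [u] has fewer than #|T| elements. *)
Lemma distance0_split M u :
  distance M set0 =
    minn (distance (delete M u) set0) (distance (delete (pivot M [set u]) u) set0).+1.
Proof.
apply/eqP; rewrite eqn_leq leq_min -andbA; apply/and3P; split.
- rewrite distance0_ge distance0_le_card; apply/forall_inP=> Z.
  by rewrite in_delete => /andP[ZM _]; apply: distance0_le.
- have [/distance0_attained[Z]|/negP/distance0_nonproper->] :=
      boolP (feasible (delete (pivot M [set u]) u) != set0); last first.
    by rewrite ltnW // ltnS distance0_le_card.
  rewrite in_delete in_pivot => /andP[ZM uZ] ->.
  by apply: leq_trans (distance0_le ZM) _; rewrite symdiff1_notin // cardsU1 uZ.
rewrite distance0_ge geq_min distance0_le_card; apply/forall_inP=> Z ZM.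
rewrite geq_min; have [uZ|uZ] := boolP (u \in Z); last first.
  by rewrite distance0_le // in_delete ZM.
rewrite orbC (cardsD1 u Z) uZ ltnS distance0_le // in_delete in_pivot.
by rewrite !inE eqxx -symdiff1_in // symdiffK ZM.
Qed.

(** If a smallest feasible [Z] contains [u], exchange at [u] against a feasible set avoiding [u]:
    the result loses [u] and gains at most one element [v], so it avoids [u] and is no larger than
    [Z]. *)
Lemma delta_matroid_distance_delete M u :
  delta_matroid M -> proper_system (delete M u) ->
  distance M set0 = distance (delete M u) set0.
Proof.
move=> [_ /distance0_attained[Z ZM dZ] exch] /set0Pn[W].
rewrite in_delete => /andP[WM uW].
apply/eqP; rewrite eqn_leq; apply/andP; split.
  by rewrite (distance0_split M u) geq_minl.
rewrite dZ; have [uZ|uZ] := boolP (u \in Z); last by rewrite distance0_le // in_delete ZM.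
have [|Zu|[v [_ vu Zuv]]] := exch Z W u ZM WM; first by rewrite in_symdiff uZ (negPf uW).
  apply: (@leq_trans #|Z (+:) [set u]|); last by rewrite symdiff1_in // subset_leq_card ?subD1set.
  by rewrite distance0_le // in_delete Zu in_symdiff1 uZ eqxx.
apply: (@leq_trans #|Z (+:) [set u; v]|).
  by rewrite distance0_le // in_delete Zuv in_symdiff uZ !inE eqxx.
have -> : [set u; v] = [set u] (+:) [set v].
  by rewrite symdiff1_notin ?inE 1?setUC.
rewrite symdiffA (symdiff1_in uZ) (cardsD1 u Z) uZ.
have [vZ|vZ] := boolP (v \in Z :\ u).
  by rewrite symdiff1_in // (leq_trans _ (leqnSn _)) // subset_leq_card ?subD1set.
by rewrite symdiff1_notin // cardsU1 vZ.
Qed.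

(** * Splitting [Q1] at an element *)

Lemma big_powersetD1 (R : nmodType) (F : {set T} -> R) A u : u \in A ->
  \sum_(X in powerset A) F X =
    \sum_(X in powerset (A :\ u)) (F X + F (u |: X)).
Proof.
move=> uA; rewrite (bigID (fun X => u \notin X)) big_split /=; congr (_ + _).
  by apply: eq_bigl => X; rewrite !powersetE subsetD1.
rewrite (reindex_onto (fun X => u |: X) (fun X => X :\ u)) /= => [|X]; last first.
  by rewrite negbK => /andP[_ uX]; rewrite setD1K.
apply: eq_bigl => X; rewrite !powersetE subsetD1 subUset sub1set uA setU11 andbT /=.
by congr (_ && _); apply/eqP/idP => [<-|uX]; rewrite ?setD11 ?setU1K.
Qed.

Lemma Q1_split M u : u \in ground M ->
  Q1 M = \sum_(X in powerset (ground M :\ u))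
    \sum_(Y in powerset (ground M :\ u) | [disjoint X & Y])
      ('X^(distance (twist M X Y) set0) +
       'X^(distance (twist (pivot M [set u]) X Y) set0) +
       'X^(distance (twist (dual_pivot1 M u) X Y) set0)).
Proof.
move=> uG; rewrite /Q1 (big_powersetD1 _ uG); apply: eq_bigr => X.
rewrite powersetE subsetD1 => /andP[_ uX]; rewrite !big_mkcondr /=.
rewrite !(big_powersetD1 _ uG) -big_split; apply: eq_bigr => Y.
rewrite powersetE subsetD1 => /andP[_ uY] /=.
rewrite -!/(twist M _ _) twistU1l // twistU1r //.
have dU A B : [disjoint u |: A & B] = (u \notin B) && [disjoint A & B].
  by rewrite !disjoints_subset subUset sub1set inE.
(* A pair with [u] in both sets is not disjoint, so three of the four terms survive. *)
rewrite !dU setU11 (disjoint_sym X (_ |: _)) dU uX uY /= addr0.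
by rewrite disjoint_sym; case: ifP; rewrite ?addr0.
Qed.

(** The dual pivot at [u] alters only sets avoiding [u], while this minor records those containing
    [u]. *)
Lemma delete_pivot_dual_pivot1 M u :
  delete (pivot (dual_pivot1 M u) [set u]) u = delete (pivot M [set u]) u.
Proof.
apply: set_system_eq => // Z; rewrite !in_delete !in_pivot in_dual_pivot1.
by rewrite in_symdiff1 eqxx; case: (u \in Z); rewrite ?andbF // addbF.
Qed.

(** Twists by sets avoiding [u] commute with deleting and pivoting [u], so the split at [u] survives
    them. *)
Lemma twist_distance0_split M X Y u : u \notin X -> u \notin Y ->
  distance (twist M X Y) set0 =
    minn (distance (twist (delete M u) X Y) set0)
         (distance (twist (delete (pivot M [set u]) u) X Y) set0).+1.
Proof.
by move=> uX uY; rewrite (distance0_split _ u) !twist_delete // twist_pivot.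
Qed.

Lemma twist_distance0_delete_lt M X Y u : u \notin X -> u \notin Y ->
  proper_system (delete M u) -> (distance (twist (delete M u) X Y) set0 < #|T|)%N.
Proof.
move=> uX uY /(twist_proper _ X Y); rewrite twist_delete //.
exact: distance0_delete_lt.
Qed.

(** * Strong divisibility in terms of the three minors *)

(** The first two minors are proper when feasible sets avoiding and containing [u] exist; the third
    is proper when some pair [Z], [Z (+:) [set u]] has exactly one feasible member. *)
Lemma strongly_divisible_byP M u : strongly_divisible_by M u <->
  [/\ proper_system (delete M u), proper_system (delete (pivot M [set u]) u)
    & proper_system (delete (dual_pivot1 M u) u)].
Proof.
split=> [[[A [B [AM BM uAB]]] [Z ZM uZM]]|[/set0Pn[A] + /set0Pn[B] + /set0Pn[Z]]].
  wlog uA : A B AM BM uAB / u \notin A.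
    move=> wl; have [uA|uA] := boolP (u \in A); last exact: (wl A B).
    by apply: (wl B A) => //; move: uAB; rewrite ?in_symdiff uA //; case: (u \in B).
  have uB : u \in B by move: uAB; rewrite in_symdiff (negPf uA).
  split; apply/set0Pn.
  - by exists A; rewrite in_delete AM.
  - by exists (B (+:) [set u]);
      rewrite in_delete in_pivot symdiffK BM in_symdiff1 uB eqxx.
  (* The third minor contains whichever member of the pair avoids [u]. *)
  have [uZ|uZ] := boolP (u \in Z); last first.
    by exists Z; rewrite in_delete in_dual_pivot1 ZM (negPf uZM) uZ.
  exists (Z (+:) [set u]).
  by rewrite in_delete in_dual_pivot1 symdiffK ZM (negPf uZM) in_symdiff1 uZ eqxx.
rewrite !in_delete in_pivot in_dual_pivot1.
move=> /andP[AM uA] /andP[BM uB] /andP[ZC uZ]; split.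
  exists A, (B (+:) [set u]); split=> //.
  by rewrite in_symdiff in_symdiff1 eqxx (negPf uA) (negPf uB).
move: ZC; rewrite uZ; have [ZM ZuM|ZM ZuM] := boolP (Z \in feasible M).
  by exists Z.
by exists (Z (+:) [set u]); rewrite ?symdiffK.
Qed.

(** * Stability of vf-closed Delta-matroids *)

(** The operation keeps the ground set, so it can be prepended to any admissible sequence. *)
Lemma vf_closed_vf_apply M o : vf_elt o \in ground M ->
  vf_closed_delta_matroid M -> vf_closed_delta_matroid (vf_apply M o).
Proof.
move=> oG hM phi; have -> : ground (vf_apply M o) = ground M by case: o oG.
by move=> phiG; apply: (hM (o :: phi)); rewrite /= oG.
Qed.

Lemma vf_closed_dual_pivot1 M u : u \in ground M ->
  vf_closed_delta_matroid M -> vf_closed_delta_matroid (dual_pivot1 M u).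
Proof.
move=> uG hM; apply: (@vf_closed_vf_apply _ (LoopC u)) => //.
apply: (@vf_closed_vf_apply _ (Pivot u)) => //.
exact: (@vf_closed_vf_apply _ (LoopC u)).
Qed.

Lemma vf_closed_pivot M Y : Y \subset ground M ->
  vf_closed_delta_matroid M -> vf_closed_delta_matroid (pivot M Y).
Proof.
move: {2}#|Y| (erefl #|Y|) => n; elim: n Y M => [|n IH] Y M.
  by move=> /eqP; rewrite cards_eq0 => /eqP->; rewrite pivot0.
move=> Yn; have /card_gt0P[u uY] : (0 < #|Y|)%N by rewrite Yn.
move=> YG hM; rewrite -(setD1K uY) -symdiff1_notin ?setD11 // -pivotD.
apply: (@vf_closed_vf_apply _ (Pivot u)); first exact: (subsetP YG).
apply: IH => //; last exact: subset_trans (subD1set _ _) YG.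
by move: Yn; rewrite (cardsD1 u) uY => -[].
Qed.

Lemma vf_closed_twist M X Y : X \subset ground M -> Y \subset ground M ->
  vf_closed_delta_matroid M -> vf_closed_delta_matroid (twist M X Y).
Proof.
move=> XG YG /(vf_closed_pivot YG); rewrite /twist /dual_pivot.
have : {subset enum X <= ground (pivot M Y)}.
  by move=> w; rewrite mem_enum; apply: (subsetP XG).
elim: (enum X) (pivot M Y) => //= w s IH K sK hK; apply: IH => [v vs|].
  by apply: sK; rewrite in_cons vs orbT.
by apply: vf_closed_dual_pivot1 => //; apply: sK; rewrite mem_head.
Qed.

(** The twisted system is again a Delta-matroid, so deleting [u] keeps its distance, and the
    deletion commutes with the twist. *)
Lemma vf_closed_twist_distance M X Y u :
  X \subset ground M -> Y \subset ground M -> u \notin X -> u \notin Y ->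
  vf_closed_delta_matroid M -> proper_system (delete M u) ->
  distance (twist M X Y) set0 = distance (twist (delete M u) X Y) set0.
Proof.
move=> XG YG uX uY hM /(twist_proper _ X Y); rewrite twist_delete //.
by apply: delta_matroid_distance_delete; apply: (vf_closed_twist XG YG hM (phi := [::])).
Qed.

(** * The recursion under strong divisibility *)

Lemma Q1_strongly_divisible M u :
  vf_closed_delta_matroid M -> u \in ground M -> strongly_divisible_by M u ->
  Q1 M = Q1 (delete M u) + Q1 (delete (pivot M [set u]) u)
         + Q1 (delete (dual_pivot M [set u]) u).
Proof.
move=> hM uG /strongly_divisible_byP[pA pB pC].
rewrite dual_pivot_set1 (Q1_split uG) /Q1 -!big_split; apply: eq_bigr => X.
rewrite powersetE subsetD1 => /andP[XG uX]; rewrite -!big_split; apply: eq_bigr => Y.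
rewrite powersetE subsetD1 => /andP[/andP[YG uY] _].
(* The three systems obtained at [u] are vf-closed with proper deletions, so each exponent equals
   that of its minor. *)
rewrite -!/(twist _ _ _); congr ('X^_ + 'X^_ + 'X^_).
- exact: vf_closed_twist_distance.
- by apply: vf_closed_twist_distance => //; apply: (@vf_closed_vf_apply _ (Pivot u)).
by apply: vf_closed_twist_distance => //; apply: vf_closed_dual_pivot1.
Qed.

(** * Reduction to one minor when strong divisibility fails *)

Lemma Q1_not_strongly_divisible_by M u :
  u \in ground M -> proper_system M -> ~ strongly_divisible_by M u ->
  exists2 N, N = delete M u \/ N = delete (pivot M [set u]) u
    & proper_system N /\ Q1 M = ('X + 2%:R) * Q1 N.
Proof.
move=> uG pM nsd.
set A := delete M u; set B := delete (pivot M [set u]) u.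
set C := delete (dual_pivot1 M u) u.
(* Hence if one of [A], [B], [C] is empty, the other two coincide. *)
have CE Z : (Z \in feasible C) = (Z \in feasible A) (+) (Z \in feasible B).
  rewrite !in_delete in_pivot in_dual_pivot1.
  by case: (u \in Z); rewrite ?andbF ?andbT.
have pAB : proper_system A \/ proper_system B.
  case/set0Pn: pM => Z ZM; have [uZ|uZ] := boolP (u \in Z); [right|left]; apply/set0Pn.
    by exists (Z (+:) [set u]);
      rewrite in_delete in_pivot symdiffK ZM in_symdiff1 uZ eqxx.
  by exists Z; rewrite in_delete ZM.
have Q1_of N : proper_system N ->
    (forall X Y, u \notin X -> u \notin Y ->
      'X^(distance (twist M X Y) set0) +
      'X^(distance (twist (pivot M [set u]) X Y) set0) +
      'X^(distance (twist (dual_pivot1 M u) X Y) set0) =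
      ('X + 2%:R) * 'X^(distance (twist N X Y) set0) :> {poly int}) ->
    ground N = ground M :\ u ->
    proper_system N /\ Q1 M = ('X + 2%:R) * Q1 N.
  move=> pN sumE gN; split=> //.
  rewrite (Q1_split uG) /Q1 gN big_distrr; apply: eq_bigr => X.
  rewrite powersetE subsetD1 => /andP[_ uX]; rewrite big_distrr; apply: eq_bigr => Y.
  by rewrite powersetE subsetD1 => /andP[/andP[_ uY] _]; apply: sumE.
have splits X Y : u \notin X -> u \notin Y ->
    [/\ distance (twist M X Y) set0 =
          minn (distance (twist A X Y) set0) (distance (twist B X Y) set0).+1,
        distance (twist (pivot M [set u]) X Y) set0 =
          minn (distance (twist B X Y) set0) (distance (twist A X Y) set0).+1
      & distance (twist (dual_pivot1 M u) X Y) set0 =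
          minn (distance (twist C X Y) set0) (distance (twist B X Y) set0).+1].
  move=> uX uY; split; rewrite (twist_distance0_split _ uX uY) //.
    by rewrite pivotK.
  by rewrite delete_pivot_dual_pivot1.
(* Exactly one exponent exceeds the common value [d], by one; this produces the factor
   ['X + 2%:R]. *)
have sumE (d d1 d2 d3 : nat) : [\/ [/\ d1 = d.+1, d2 = d & d3 = d],
    [/\ d1 = d, d2 = d.+1 & d3 = d] | [/\ d1 = d, d2 = d & d3 = d.+1]] ->
    'X^d1 + 'X^d2 + 'X^d3 = ('X + 2%:R) * 'X^d :> {poly int}.
  by case=> -[-> -> ->]; rewrite exprS; ring.
have nonproper K : feasible K = set0 ->
    forall X Y, distance (twist K X Y) set0 = #|T|.
  move=> K0 X Y; apply: distance0_nonproper => /twist_proper.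
  by rewrite /proper_system K0 eqxx.
have [A0|pA] := eqVneq (feasible A) set0.
  have pB : proper_system B by case: pAB => //; rewrite /proper_system A0 eqxx.
  have CB : C = B by apply: set_system_eq => // Z; rewrite CE A0 in_set0.
  exists B; [by right | apply: Q1_of => // X Y uX uY].
  have [-> -> ->] := splits X Y uX uY; rewrite CB (nonproper A A0).
  (* The empty [A] has distance [#|T|]; as [d < #|T|] for the distance [d] of [B], the minimum of
     [#|T|] and [d.+1] is [d.+1]. *)
  have := twist_distance0_delete_lt uX uY pB; rewrite -/B => dB.
  by apply: sumE; constructor 1; split; lia.
exists A; [by left | apply: Q1_of => // X Y uX uY].
have [-> -> ->] := splits X Y uX uY.
have := twist_distance0_delete_lt uX uY pA; rewrite -/A => dA.
have [B0|pB] := eqVneq (feasible B) set0.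
  have -> : C = A by apply: set_system_eq => // Z; rewrite CE B0 in_set0 addbF.
  by rewrite (nonproper B B0); apply: sumE; constructor 2; split; lia.
(* With [A] and [B] proper, a proper [C] would make [M] strongly divisible by [u]. *)
have [C0|pC] := eqVneq (feasible C) set0; last first.
  by case: nsd; apply/strongly_divisible_byP.
have -> : B = A.
  apply: set_system_eq => // Z; move: (CE Z); rewrite C0 in_set0.
  by case: (Z \in _); case: (Z \in _).
by rewrite (nonproper C C0); apply: sumE; constructor 3; split; lia.
Qed.

(** * Induction on the ground set *)

(** Since [w] differs from [u], both [Z] and [Z (+:) [set w]] avoid [u], and on such sets [M] and
    its deletion agree. *)
Lemma strongly_divisible_delete M u :
  strongly_divisible (delete M u) -> strongly_divisible M.
Proof.
case=> w /setD1P[wu wG] [[A [B [+ + wAB]]] [Z + ZwM]].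
rewrite !in_delete => /andP[AM _] /andP[BM _] /andP[ZM uZ].
exists w => //; split; first by exists A, B.
exists Z => //; apply: contra ZwM.
by rewrite in_delete in_symdiff1 (negPf uZ) eq_sym (negPf wu) andbT.
Qed.

(** As for deletion, with all witnesses translated by [[set u]], which leaves membership of [w]
    unchanged. *)
Lemma strongly_divisible_delete_pivot M u :
  strongly_divisible (delete (pivot M [set u]) u) -> strongly_divisible M.
Proof.
case=> w /setD1P[wu wG] [[A [B [+ + wAB]]] [Z + ZwM]].
rewrite !in_delete !in_pivot => /andP[AM _] /andP[BM _] /andP[ZM uZ].
exists w => //; split.
  exists (A (+:) [set u]), (B (+:) [set u]); split=> //.
  by rewrite in_symdiff !in_symdiff1 (negPf wu) !addbF -in_symdiff.
exists (Z (+:) [set u]) => //; apply: contra ZwM.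
by rewrite in_delete in_pivot symdiffAC in_symdiff1 (negPf uZ) eq_sym (negPf wu) andbT.
Qed.

Lemma is_set_system_delete M u :
  is_set_system M -> is_set_system (delete M u).
Proof.
move=> /subsetP sM; apply/subsetP=> Z; rewrite in_delete => /andP[/sM].
by rewrite !powersetE subsetD1 => -> ->.
Qed.

Lemma is_set_system_pivot M Y : Y \subset ground M ->
  is_set_system M -> is_set_system (pivot M Y).
Proof.
move=> YG /subsetP sM; apply/subsetP=> Z; rewrite in_pivot => /sM.
rewrite !powersetE => ZYG; apply/subsetP=> x xZ.
have [/(subsetP YG)//|xY] := boolP (x \in Y).
by apply: (subsetP ZYG); rewrite in_symdiff xZ (negPf xY).
Qed.

Lemma Q1_not_strongly_divisible M :
  is_set_system M -> proper_system M -> ~ strongly_divisible M ->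
  Q1 M = ('X + 2%:R) ^+ #|ground M|.
Proof.
move: {2}#|ground M| (erefl #|ground M|) => n; elim: n M => [|n IH] M Gn sM pM nsd.
  (* Over an empty ground set the only feasible set is empty, and the single pair of empty sets
     contributes ['X^0]. *)
  move/eqP: (Gn); rewrite cards_eq0 => /eqP G0.
  have d0 : distance M set0 = 0%N.
    case/set0Pn: pM => Z ZM; move/subsetP/(_ _ ZM): sM.
    rewrite powersetE G0 subset0 => /eqP Z0.
    by have := distance0_le ZM; rewrite Z0 cards0 leqn0 => /eqP.
  rewrite Gn /Q1 G0 powerset0 big_set1 big_mkcondr big_set1 disjoints_subset sub0set.
  by rewrite pivot0 /dual_pivot enum_set0 /= d0.
have /card_gt0P[u uG] : (0 < #|ground M|)%N by rewrite Gn.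
have [] := Q1_not_strongly_divisible_by uG pM.
  by move=> sd; apply: nsd; exists u.
move=> N NE [pN ->]; rewrite Gn exprS; congr (_ * _).
have gN : #|ground N| = n.
  by case: NE => ->; rewrite /=; move: Gn; rewrite (cardsD1 u) uG => -[].
rewrite -[in RHS]gN; apply: IH => //.
  case: NE => ->; apply: is_set_system_delete => //.
  by apply: is_set_system_pivot; rewrite ?sub1set.
move=> sN; apply: nsd; case: NE sN => ->.
  exact: strongly_divisible_delete.
exact: strongly_divisible_delete_pivot.
Qed.

End SetSystemTheory.

Theorem theorem21 (T : finType) (M : set_system T)
    (hM : vf_closed_delta_matroid M) :
  (forall u : T, u \in ground M -> strongly_divisible_by M u ->
     Q1 M = Q1 (delete M u) + Q1 (delete (pivot M [set u]) u)
            + Q1 (delete (dual_pivot M [set u]) u))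
  /\
  (~ strongly_divisible M -> Q1 M = ('X + 2%:R) ^+ #|ground M|).
Proof.
split=> [u|]; first exact: Q1_strongly_divisible.
(* The empty sequence of operations shows that [M] itself is a Delta-matroid. *)
have [sM pM _] := hM [::] isT.
exact: Q1_not_strongly_divisible.
Qed.
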